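(* Let $z=(x,y)$ be a data point and $z^{(\mathrm{val})}=(x^{(\mathrm{val})},y^{(\mathrm{val})})$ a validation point for a classification task with $C$ classes. Let $\phi^{\mathrm{KNN}}_z(D_{-z};z^{(\mathrm{val})})$ be the KNN-Shapley value of $z$ in the training set $D_{-z}\cup\{z\}$, and define its global sensitivity $$\Delta(\phi^{\mathrm{KNN}}_z;z^{(\mathrm{val})})=\sup_{D_{-z}\sim D_{-z}'}\big|\phi^{\mathrm{KNN}}_z(D_{-z};z^{(\mathrm{val})})-\phi^{\mathrm{KNN}}_z(D_{-z}';z^{(\mathrm{val})})\big|.$$ Then $$\Delta(\phi^{\mathrm{KNN}}_z;z^{(\mathrm{val})})\ \ge\ \tfrac12\big(\mathbf 1[y=y^{(\mathrm{val})}]-1/C\big).$$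
   Context: Datasets are finite multisets of labelled points; $D_{-z}\sim D_{-z}'$ (adjacent) means one is obtained from the other by adding or removing one data point. The supremum is over all adjacent pairs of datasets of arbitrary size. Fix an integer $K\ge1$ and a distance metric $d$. For a training set $S$, let $\pi^{(S)}(j;x^{(\mathrm{val})})$ be the index of the $j$-th closest point of $S$ to $x^{(\mathrm{val})}$ under $d$ (ties broken by a fixed rule). The KNN utility is $$v^{\mathrm{KNN}}_{z^{(\mathrm{val})}}(S)=\frac1{\min(K,|S|)}\sum_{j=1}^{\min(K,|S|)}\mathbf 1\big[y_{\pi^{(S)}(j;x^{(\mathrm{val})})}=y^{(\mathrm{val})}\big]\quad(S\ne\emptyset),\qquad v^{\mathrm{KNN}}_{z^{(\mathrm{val})}}(\emptyset)=1/C.$$ The KNN-Shapley value is the Shapley value for this utility: with $N=|D_{-z}|+1$, $$\phi^{\mathrm{KNN}}_z(D_{-z};z^{(\mathrm{val})})=\frac1N\sum_{k=1}^{N}\binom{N-1}{k-1}^{-1}\sum_{S\subseteq D_{-z},\,|S|=k-1}\big[v^{\mathrm{KNN}}_{z^{(\mathrm{val})}}(S\cup\{z\})-v^{\mathrm{KNN}}_{z^{(\mathrm{val})}}(S)\big].$$ *)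

(* Defs.v *)
From mathcomp Require Import all_boot all_order all_algebra.
From mathcomp Require Import finmap multiset.
From mathcomp Require Import all_classical all_reals all_analysis.

Set Implicit Arguments.
Unset Strict Implicit.
Unset Printing Implicit Defensive.

Import Order.TTheory GRing.Theory Num.Theory.
Local Open Scope classical_set_scope.
Local Open Scope mset_scope.
Local Open Scope ring_scope.

Section Datasets.
Context {R : realType} {Z : choiceType}.
Implicit Types (D S : {mset Z}) (z : Z) (v f : {mset Z} -> R).

(* Sub-datasets of D are indexed by sets of positions in D, so that copies of a
   repeated point are distinct members of D: there are 'C(size D, k)
   sub-datasets of size k, whatever the multiplicities in D. *)
Definition subdataset D (A : {set 'I_(size D)}) : {mset Z} :=
  seq_mset [seq tnth (in_tuple D) i | i in A].

Definition shapley v z D : R :=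
  let N := (size D).+1 in
  N%:R^-1 * \sum_(1 <= k < N.+1) ('C(N.-1, k.-1)%:R^-1 *
    \sum_(A : {set 'I_(size D)} | #|A| == k.-1)
      (v (z +` subdataset A) - v (subdataset A))).

Definition adjacent_datasets D D' : Prop :=
  exists w, D' = w +` D \/ D = w +` D'.

Definition global_sensitivity f : \bar R :=
  ereal_sup [set e | exists D D', adjacent_datasets D D' /\ e = (`|f D - f D'|)%:E].

End Datasets.

Section KNN.
Context {R : realType} {X : metricType R} {C : nat}.

Local Notation point := (X * 'I_C)%type.

(* rk x S lists S (with multiplicities) from closest to farthest from x. Which
   listing is chosen among points at equal distance is the tie-breaking rule;
   it is left arbitrary, but being a function of x and S it is fixed. *)
Definition nearest_ranking (rk : X -> {mset point} -> seq point) : Prop :=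
  forall x S, perm_eq (rk x S) S /\
    sorted (fun a b => mdist x a.1 <= mdist x b.1) (rk x S).

(* Positions in rk start at 0. The default value zval of nth is never reached,
   since rk zval.1 S has size (size S). *)
Definition knn_utility (K : nat) (rk : X -> {mset point} -> seq point)
    (zval : point) (S : {mset point}) : R :=
  if S == mset0 then C%:R^-1
  else let m := minn K (size S) in
    m%:R^-1 * \sum_(j < m) ((nth zval (rk zval.1 S) j).2 == zval.2)%:R.

Definition knn_shapley (K : nat) (rk : X -> {mset point} -> seq point)
    (zval z : point) (D : {mset point}) : R :=
  shapley (knn_utility K rk zval) z D.

End KNN.

(* Main.v *)
(* Compare the empty training set with the training set consisting of zval
   alone. Only subsets of size at most 1 occur, so the two Shapley values
   are v{z} - v{} and the mean of v{z} - v{} and v{z,zval} - v{zval}. Their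
   difference is half of (v{z} - v{}) + (v{zval} - v{z,zval}); here the second
   summand is nonnegative because v{zval} = 1 is the largest possible utility. *)
Require Import Defs.
From mathcomp Require Import all_boot all_order all_algebra.
From mathcomp Require Import finmap multiset.
From mathcomp Require Import all_classical all_reals all_analysis.
From mathcomp Require Import lra.

Set Implicit Arguments.
Unset Strict Implicit.
Unset Printing Implicit Defensive.

Import Order.TTheory GRing.Theory Num.Theory.

Local Open Scope mset_scope.
Local Open Scope ring_scope.

Lemma seq_mset_nil (Z : choiceType) : seq_mset [::] = mset0 :> {mset Z}.
Proof. by apply/msetP => a; rewrite mset_seqE mset0E. Qed.

(** The enumeration of a multiset is known only up to permutation, but a list of length one has no
    other permutation. *)
Lemma enum_mset1 (Z : choiceType) (w : Z) : [mset w] = [:: w] :> seq Z.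
Proof.
apply: perm_small_eq => //.
by rewrite -[X in perm_eq X _](congr1 _ (msetD0 [mset w])) -seq_mset_nil
  -mset_cons perm_eq_seq_mset.
Qed.

Lemma subdataset_set0 (Z : choiceType) (D : {mset Z}) :
  subdataset (finset.set0 : {set 'I_(size D)}) = mset0.
Proof. by rewrite /subdataset /image_mem enum_set0 seq_mset_nil. Qed.

Lemma subdataset_setT (Z : choiceType) (D : {mset Z}) :
  subdataset [set: 'I_(size D)]%SET = D.
Proof.
rewrite -[RHS]seq_mset_id /subdataset /image_mem enum_setT -enumT.
congr seq_mset. exact: (map_tnth_enum (in_tuple D)).
Qed.

Lemma sum_subdataset_card0 (R : realType) (Z : choiceType)
    (g : {mset Z} -> R) (D : {mset Z}) :
  \sum_(A : {set 'I_(size D)} | #|A| == 0%N) g (subdataset A) = g mset0.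
Proof.
rewrite (big_pred1 finset.set0) ?subdataset_set0 // => A.
by rewrite cards_eq0.
Qed.

(** Only the full set of positions has maximal cardinality. The separate [n] lets the cardinality in
    the sum be a numeral. *)
Lemma sum_subdataset_card_size (R : realType) (Z : choiceType)
    (g : {mset Z} -> R) (D : {mset Z}) (n : nat) : size D = n ->
  \sum_(A : {set 'I_(size D)} | #|A| == n) g (subdataset A) = g D.
Proof.
move=> <-; rewrite (big_pred1 finset.setT) ?subdataset_setT // => A.
have := max_card A; rewrite card_ord => leA.
by rewrite /= eqEcard finset.subsetT cardsT card_ord eqn_leq leA.
Qed.

(* Only the numeric occurrences of size D are replaced: the subsets A keep
   their type, on which subdataset depends. *)
Lemma shapley_sizeE (R : realType) (Z : choiceType) (v : {mset Z} -> R) (z : Z)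
    (D : {mset Z}) (n : nat) : size D = n ->
  shapley v z D = n.+1%:R^-1 * \sum_(1 <= k < n.+2) ('C(n, k.-1)%:R^-1 *
    \sum_(A : {set 'I_(size D)} | #|A| == k.-1)
      (v (z +` subdataset A) - v (subdataset A))).
Proof. by move=> <-. Qed.

Lemma shapley_mset0 (R : realType) (Z : choiceType) (v : {mset Z} -> R) (z : Z) :
  shapley v z mset0 = v [mset z] - v mset0.
Proof.
rewrite (shapley_sizeE _ _ size_mset0) big_nat1 /= bin0 invr1 !mul1r.
by rewrite (sum_subdataset_card0 (fun S => v (z +` S) - v S)) msetD0.
Qed.

Lemma shapley_mset1 (R : realType) (Z : choiceType) (v : {mset Z} -> R) (z w : Z) :
  shapley v z [mset w] =
  2^-1 * ((v [mset z] - v mset0) + (v [mset z; w] - v [mset w])).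
Proof.
have sz : size [mset w] = 1%N by rewrite enum_mset1.
(* The terms [k = 1] and [k = 2] remain; both binomial coefficients are 1, so they get equal
   weight. *)
rewrite (shapley_sizeE _ _ sz) big_nat_recl // big_nat1 /= bin0 bin1 invr1 !mul1r.
rewrite (sum_subdataset_card_size (fun S => v (z +` S) - v S) sz).
by rewrite (sum_subdataset_card0 (fun S => v (z +` S) - v S)) msetD0.
Qed.

Section KnnUtility.
Context {R : realType} {X : metricType R} {C K : nat}.
Context {rk : X -> {mset (X * 'I_C)%type} -> seq (X * 'I_C)%type}.
Implicit Types (z zval : X * 'I_C) (S : {mset (X * 'I_C)%type}).

Lemma knn_utility_mset0 zval : knn_utility K rk zval mset0 = C%:R^-1.
Proof. by rewrite /knn_utility eqxx. Qed.

Context (K_gt0 : (1 <= K)%N).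

(** A single point has only one ranking, so the tie-breaking rule has no influence; [K_gt0] makes
    the minimum 1. *)
Lemma knn_utility_mset1 zval z : nearest_ranking rk ->
  knn_utility K rk zval [mset z] = (z.2 == zval.2)%:R.
Proof.
move=> hrk; rewrite /knn_utility -size_mset_eq0.
have [p _] := hrk zval.1 [mset z].
rewrite enum_mset1 in p *; rewrite (perm_small_eq _ p) //=.
by rewrite (minn_idPr K_gt0) invr1 mul1r big_ord1.
Qed.

Lemma knn_utility_le1 zval S : S != mset0 -> knn_utility K rk zval S <= 1.
Proof.
move=> S0; rewrite /knn_utility (negbTE S0).
rewrite -size_mset_eq0 -lt0n in S0.
rewrite ler_pdivrMl ?ltr0n ?leq_min ?K_gt0 // mulr1.
(* The bound [m] becomes a sum of [m] ones, to be compared termwise with the indicators. *)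
rewrite -[X in _ <= X%:R]card_ord -sum1_card natr_sum.
by apply: ler_sum => j _; rewrite lern1 leq_b1.
Qed.

End KnnUtility.

Theorem theorem9 (R : realType) (X : metricType R) (C K : nat) (hK : (1 <= K)%N)
    (rk : X -> {mset (X * 'I_C)%type} -> seq (X * 'I_C)%type)
    (hrk : nearest_ranking rk) (z zval : X * 'I_C) :
  ((2^-1 * ((z.2 == zval.2)%:R - C%:R^-1))%:E
     <= global_sensitivity (knn_shapley K rk zval z))%E.
Proof.
apply: (@le_trans _ _ `|knn_shapley K rk zval z mset0
                        - knn_shapley K rk zval z [mset zval]|%:E); last first.
  apply: ereal_sup_ubound; exists mset0, [mset zval]; split=> //.
  by exists zval; left; rewrite msetD0.
have le1 : knn_utility K rk zval [mset z; zval] <= 1.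
  apply: knn_utility_le1 => //; apply/eqP => /msetP/(_ z).
  by rewrite mset1DE mset0E eqxx.
(* With the empty dataset first, the signed difference already satisfies the bound. *)
rewrite lee_fin; apply: le_trans (ler_norm _).
rewrite /knn_shapley shapley_mset0 shapley_mset1 knn_utility_mset0.
rewrite !knn_utility_mset1 // eqxx mulr1n.
lra.
Qed.
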